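(* There is an absolute constant $c>0$ such that for every $n \ge 2$ and every graph $H$ on $n$ vertices with at least one edge, \[ Q(f_H) \ge c\sqrt{\alpha_H \cdot n}. \]
   Context: Graphs are simple and undirected. For a fixed graph $H$ on vertex set $[n]=\{1,\dots,n\}$ (isolated vertices allowed), $f_H:\{0,1\}^{\binom{n}{2}}\to\{0,1\}$ takes as input a graph $G$ on vertex set $[n]$, given by its $\binom n2$ edge-indicator bits, and $f_H(G)=1$ iff $H$ is isomorphic to a (not necessarily induced) subgraph of $G$. $Q(f)$ denotes the bounded-error (success probability at least $2/3$ on every input) quantum query complexity of a Boolean function $f$, where a query to the input $x$ reveals one bit $x_i$ (standard phase/oracle query model). $\alpha_H$ denotes the size of a maximum independent set of $H$. *)

(* Defs.v *)
From HB Require Import structures.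
From mathcomp Require Import all_boot all_order all_algebra.
From mathcomp Require Import fingroup perm spectral.
Set Implicit Arguments. Unset Strict Implicit. Unset Printing Implicit Defensive.
Import Order.TTheory GRing.Theory Num.Theory.
Local Open Scope ring_scope.

Definition edge (n : nat) : predArgType := {p : 'I_n * 'I_n | (p.1 < p.2)%N}.

Definition graph (n : nat) := {ffun edge n -> bool}.

Definition adj n (G : graph n) (u v : 'I_n) : bool :=
  match @idP (u < v)%N, @idP (v < u)%N with
  | ReflectT huv, _ => G (exist _ (u, v) huv)
  | _, ReflectT hvu => G (exist _ (v, u) hvu)
  | _, _ => false
  end.

(* f_H(G) = 1 iff H is isomorphic to a (not necessarily induced) subgraph of G;
   since both have vertex set [n], this means some permutation of [n]
   maps every edge of H to an edge of G. *)
Definition f_H n (H : graph n) (G : graph n) : bool :=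
  [exists s : {perm 'I_n}, [forall u, [forall v, adj H u v ==> adj G (s u) (s v)]]].

Definition independent n (H : graph n) (S : {set 'I_n}) : bool :=
  [forall u in S, [forall v in S, ~~ adj H u v]].

Definition alpha n (H : graph n) : nat :=
  \max_(S : {set 'I_n} | independent H S) #|S|.

Section Quantum.
Variable C : numClosedFieldType.
Variable I : finType.

(* A T-query algorithm: a Hilbert space C^(dim+1) with computational basis
   'I_(dim+1); each basis state j is labelled by the index it queries
   (qidx j = Some i) or by None (no query); unitaries U_0,...,U_T;
   the final measurement in the computational basis is post-processed by
   [out]. The initial state is the basis state 0. *)
Record qalg (T : nat) := QAlg {
  qdim : nat;
  qidx : 'I_qdim.+1 -> option I;
  qU : 'I_T.+1 -> 'M[C]_qdim.+1;
  qout : 'I_qdim.+1 -> bool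
}.
Arguments qdim {T} q.
Arguments qidx {T} q _.
Arguments qU {T} q _.
Arguments qout {T} q _.

Definition oracle T (A : qalg T) (x : {ffun I -> bool}) : 'M[C]_((qdim A).+1) :=
  diag_mx (\row_j match qidx A j with Some i => (-1) ^+ x i | None => 1 end).

Fixpoint qstate T (A : qalg T) (x : {ffun I -> bool}) (t : nat)
  : 'rV[C]_((qdim A).+1) :=
  match t with
  | 0 => delta_mx 0 0 *m qU A (inord 0)
  | t'.+1 => qstate A x t' *m oracle A x *m qU A (inord t'.+1)
  end.

Definition out_prob T (A : qalg T) (x : {ffun I -> bool}) (b : bool) : C :=
  \sum_(j | qout A j == b) `|qstate A x T 0 j| ^+ 2.

Definition computes T (A : qalg T) (f : {ffun I -> bool} -> bool) : Prop :=
  (forall t, qU A t \is unitarymx) /\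
  (forall x, 2 / 3 <= out_prob A x (f x)).

Definition Q_ge (f : {ffun I -> bool} -> bool) (b : C) : Prop :=
  forall (T : nat) (A : qalg T), computes A f -> b <= T%:R.

End Quantum.

(* Main.v *)
(** By the adversary method it is enough to relate 1-inputs and 0-inputs so that
    no single edge distinguishes more than a 1/p (resp. 1/q) fraction of the
    relatives of a 1-input (resp. 0-input): then at least sqrt(pq)/72 queries are
    needed. Let J be a maximum independent set of H, alpha = |J|, tau = n - alpha
    and let d be the least number of neighbours in J of a vertex outside J.

    If tau >= n/32, take graphs consisting of a set S of universal vertices and no
    other edge: they contain H for |S| = tau but not for |S| = tau - 1, and moving
    one vertex in or out of S gives p = tau and q about alpha/2.

    Otherwise alpha is close to n, and tau - 1 universal vertices are kept
    throughout; a star with d leaves on the other N = alpha + 1 vertices completes a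
    copy of H. If d <= N/4, let k be least such that N/(4k) disjoint k-stars do so
    too; while (k-1)-stars are turned into k-stars one at a time, some step j creates
    H, and the leaves that can be removed or added there give pq >= N^2/16. If
    d > N/4, the vertices outside J have such a large degree that they must be
    embedded into the clique formed by the universal vertices and N/8 further
    vertices, each with d - 1 neighbours among the N; so H appears exactly when one
    of these acquires a d-th neighbour. *)
Require Import Defs.
From HB Require Import structures.
From mathcomp Require Import all_boot all_order all_algebra.
From mathcomp Require Import fingroup perm spectral.
From mathcomp Require Import zify ring.
Set Implicit Arguments. Unset Strict Implicit. Unset Printing Implicit Defensive.
Import Order.TTheory GRing.Theory Num.Theory.
Local Open Scope ring_scope.

(** * The adversary method *)

Section Adversary.
Variable C : numClosedFieldType.

Definition sqnorm m (v : 'rV[C]_m) : C := \sum_j `|v 0 j| ^+ 2.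

Lemma sqnorm_unitary m (v : 'rV[C]_m) (U : 'M[C]_m) :
  U \is unitarymx -> sqnorm (v *m U) = sqnorm v.
Proof.
have sqnormE (w : 'rV[C]_m) : sqnorm w = (w *m (map_mx Num.conj w^T)) 0 0.
  by rewrite mxE; apply: eq_bigr => j _; rewrite !mxE normCK.
move=> /unitarymxP UU; rewrite !sqnormE trmx_mul map_mxM.
by rewrite mulmxA -(mulmxA v) UU mulmx1.
Qed.

(** The gap is [2 * c * |a - b / c|^2]. The free weight [c] lets the two inputs of a pair be charged
    unequally, which leads to the product [p * q]. *)
Lemma sqr_normD_le (c a b : C) : 0 < c ->
  `|a + b| ^+ 2 <= `|a - b| ^+ 2 + (2 * c * `|a| ^+ 2 + 2 / c * `|b| ^+ 2).
Proof.
move=> c0; rewrite -subr_ge0.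
suff -> : `|a - b| ^+ 2 + (2 * c * `|a| ^+ 2 + 2 / c * `|b| ^+ 2) - `|a + b| ^+ 2
    = 2 * c * `|a - b / c| ^+ 2.
  by rewrite !mulr_ge0 ?exprn_ge0 // ltW.
have cr : c^* = c by apply/CrealP/gtr0_real.
have cn0 : c != 0 by rewrite gt_eqF.
rewrite !normCK !rmorphB !rmorphD rmorphM fmorphV /= cr.
by field.
Qed.

(** The gap is [2 * |a - 3/2 b|^2]. With weight 3/2 an error probability of 1/3 contributes only
    1/2, below the success probability 2/3. *)
Lemma sqr_norm_le (a b : C) : `|a| ^+ 2 <= 3 * `|a - b| ^+ 2 + 3 / 2 * `|b| ^+ 2.
Proof.
rewrite -subr_ge0.
suff -> : 3 * `|a - b| ^+ 2 + 3 / 2 * `|b| ^+ 2 - `|a| ^+ 2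
    = 2 * `|a - 3 / 2 * b| ^+ 2.
  by rewrite !mulr_ge0 ?exprn_ge0.
have cr : (3 / 2 : C)^* = 3 / 2.
  by apply/CrealP; rewrite ger0_real ?divr_ge0.
rewrite !normCK !rmorphB rmorphM /= cr.
by field.
Qed.

Variable I : finType.
Variables (T : nat) (A : qalg C I T) (f : {ffun I -> bool} -> bool).
Hypothesis compA : computes A f.

Definition queried_differ (x y : {ffun I -> bool}) (j : 'I_(qdim A).+1) : bool :=
  if qidx j is Some i then x i != y i else false.

Lemma oracleE x (v : 'rV[C]_(qdim A).+1) j :
  (v *m oracle A x) 0 j =
  v 0 j * (if qidx j is Some i then (-1) ^+ x i else 1).
Proof. by rewrite /oracle mul_mx_diag !mxE. Qed.

Lemma sqnorm_qstate x t : sqnorm (qstate A x t) = 1.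
Proof.
elim: t => [|t IH] /=; rewrite sqnorm_unitary; try exact: (proj1 compA).
  rewrite /sqnorm (bigD1 0) //= big1 ?addr0.
    by rewrite mxE !eqxx normr1 expr1n.
  by move=> j /negPf j0; rewrite mxE eqxx j0 normr0 expr0n.
rewrite -IH; apply: eq_bigr => j _; rewrite oracleE normrM.
by case: (qidx j) => [i|]; rewrite ?normr1 ?mulr1 // normrX normrN1 expr1n mulr1.
Qed.

(** Unitaries preserve the distance, and a query changes the modulus of an entry [a - b] of the
    difference only where the queried bits differ: there it becomes [a + b] up to sign. *)
Lemma qstate_step (c : C) x y t : 0 < c ->
  sqnorm (qstate A x t.+1 - qstate A y t.+1) <=
  sqnorm (qstate A x t - qstate A y t) +
  \sum_(j | queried_differ x y j)
     (2 * c * `|qstate A x t 0 j| ^+ 2 + 2 / c * `|qstate A y t 0 j| ^+ 2).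
Proof.
move=> c0 /=; rewrite -mulmxBl sqnorm_unitary; last exact: (proj1 compA).
rewrite /sqnorm [X in _ <= _ + X]big_mkcond -big_split /=.
apply: ler_sum => j _; rewrite mxE [X in `|_ + X|]mxE !oracleE.
rewrite [in X in _ <= X]mxE [(- qstate A y t) 0 j]mxE /queried_differ.
set a := qstate A x t 0 j; set b := qstate A y t 0 j.
case: (qidx j) => [i|] /=; last by rewrite !mulr1 addr0.
case: (x i) (y i) => [] [] /=; rewrite ?expr1 ?expr0 ?mulrN1 ?mulr1 ?addr0 //.
- by rewrite -opprD normrN.
- by rewrite -normrN opprD !opprK; apply: sqr_normD_le.
- by rewrite opprK; apply: sqr_normD_le.
Qed.

(** The basis states with output [true] carry weight at least 2/3 for [x] and at most 1/3 for [y],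
    so [sqr_norm_le] gives [2/3 <= 3 * D + 1/2]. *)
Lemma qstate_final x y : f x -> ~~ f y ->
  1 / 18 <= sqnorm (qstate A x T - qstate A y T).
Proof.
move=> fx fy.
have := proj2 compA x; have := proj2 compA y; rewrite fx (negPf fy) => py px.
set D := sqnorm _.
have y1 : out_prob A y true + out_prob A y false = 1.
  rewrite -(sqnorm_qstate y T) /sqnorm (bigID (fun j => qout j == true)) /=.
  by rewrite /out_prob; congr (_ + _); apply: eq_bigl => j; case: (qout j).
have py1 : out_prob A y true <= 1 / 3.
  have -> : 1 / 3 = 1 - 2 / 3 :> C by field.
  by rewrite lerBrDr -[leRHS]y1 lerD2l.
have le1 : out_prob A x true <= 3 * D + 3 / 2 * out_prob A y true.
  apply: (@le_trans _ _ (\sum_(j | qout j == true)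
     (3 * `|(qstate A x T - qstate A y T) 0 j| ^+ 2 + 3 / 2 * `|qstate A y T 0 j| ^+ 2))).
    apply: ler_sum => j _; rewrite !mxE; exact: sqr_norm_le.
  rewrite big_split /= -!mulr_sumr lerD2r ler_pM2l // /D /sqnorm.
  by rewrite [leRHS](bigID (fun j => qout j == true)) /= lerDl sumr_ge0 // => j _; rewrite exprn_ge0.
have le2 : 2 / 3 <= 3 * D + 3 / 2 * (1 / 3).
  apply: le_trans px (le_trans le1 _).
  by rewrite lerD2l ler_pM2l // divr_gt0.
have -> : D = (3 * D + 3 / 2 * (1 / 3) - 1 / 2) / 3 by field.
have -> : 1 / 18 = (2 / 3 - 1 / 2) / 3 :> C by field.
by rewrite ler_pM2r ?invr_gt0 // lerD2r.
Qed.

(** * Related inputs and the progress function *)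

Variables (X Y : finType) (xi : X -> {ffun I -> bool}) (eta : Y -> {ffun I -> bool}).
Variables (R : X -> Y -> bool) (p q : nat).
Hypothesis fR : forall x y, R x y -> f (xi x) && ~~ f (eta y).
Hypothesis leX : forall x i,
  (p * #|[set y | R x y & xi x i != eta y i]| <= #|[set y | R x y]|)%N.
Hypothesis leY : forall y i,
  (q * #|[set x | R x y & xi x i != eta y i]| <= #|[set x | R x y]|)%N.

Let nR := (\sum_x #|[set y | R x y]|)%N.

Let nR_exchange : nR = (\sum_y #|[set x | R x y]|)%N.
Proof.
transitivity (\sum_x \sum_y (R x y : nat))%N.
  by apply: eq_bigr => x _; rewrite -sum1dep_card big_mkcond.
rewrite exchange_big /=.
by apply: eq_bigr => x _; rewrite -sum1dep_card [in RHS]big_mkcond.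
Qed.

(** The progress measure: zero at the start and at least [nR / 18] at the end. *)
Let Phi t : C := \sum_x \sum_(y | R x y)
  sqnorm (qstate A (xi x) t - qstate A (eta y) t).

(** After exchanging the sums, each basis state is counted for at most a 1/r fraction of the
    relatives of [z], and the squared amplitudes sum to 1. The relation is general so that both [R]
    and its converse can be used. *)
Lemma weight_queried_differ (Z W : finType) (zeta : Z -> {ffun I -> bool})
    (omega : W -> {ffun I -> bool}) (S : Z -> W -> bool) (r : nat) t : (0 < r)%N ->
  (forall z i, (r * #|[set w | S z w & zeta z i != omega w i]| <=
                #|[set w | S z w]|)%N) ->
  \sum_z \sum_(w | S z w) \sum_(j | queried_differ (zeta z) (omega w) j)
    `|qstate A (zeta z) t 0 j| ^+ 2 <= (\sum_z #|[set w | S z w]|)%N%:R / r%:R.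
Proof.
move=> r0 leS; rewrite natr_sum mulr_suml; apply: ler_sum => z _.
rewrite (exchange_big_dep predT) //=.
rewrite -[leRHS]mulr1 -[X in _ <= _ * X](sqnorm_qstate (zeta z) t) mulr_sumr.
apply: ler_sum => j _; rewrite sumr_const -[leLHS]mulr_natl.
apply: ler_wpM2r; first by rewrite exprn_ge0.
rewrite ler_pdivlMr ?ltr0n // -natrM ler_nat mulnC /queried_differ.
case: (qidx j) => [i|]; last first.
  by rewrite (eq_card (B := pred0)) ?card0 ?muln0 // => w; rewrite [LHS]andbF.
by apply: leq_trans (leS z i); rewrite leq_mul2l; apply/orP; right;
  apply: subset_leq_card; apply/subsetP => w; rewrite !inE.
Qed.

Lemma Phi_step (c : C) t : (0 < p)%N -> (0 < q)%N -> 0 < c ->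
  Phi t.+1 <= Phi t + (2 * c / p%:R + 2 / c / q%:R) * nR%:R.
Proof.
move=> p0 q0 c0.
apply: (@le_trans _ _ (Phi t +
  (2 * c * (\sum_x \sum_(y | R x y) \sum_(j | queried_differ (xi x) (eta y) j)
    `|qstate A (xi x) t 0 j| ^+ 2) +
   2 / c * (\sum_x \sum_(y | R x y) \sum_(j | queried_differ (xi x) (eta y) j)
    `|qstate A (eta y) t 0 j| ^+ 2)))).
  rewrite /Phi !mulr_sumr -!big_split /=; apply: ler_sum => x _.
  rewrite !mulr_sumr -!big_split /=; apply: ler_sum => y _.
  apply: le_trans (qstate_step _ _ _ c0) _.
  by rewrite lerD2l !mulr_sumr -big_split.
have -> : (2 * c / p%:R + 2 / c / q%:R) * nR%:R =
    2 * c * (nR%:R / p%:R) + 2 / c * (nR%:R / q%:R) by ring.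
rewrite lerD2l; apply: lerD; rewrite ler_pM2l ?mulr_gt0 ?invr_gt0 //.
  exact: weight_queried_differ leX.
rewrite (exchange_big_dep predT) //= nR_exchange.
apply: le_trans (weight_queried_differ (S := fun y x => R x y) (zeta := eta) (omega := xi) t q0 _).
  apply: ler_sum => y _; apply: ler_sum => x _.
  rewrite le_eqVlt; apply/orP; left; apply/eqP; apply: eq_bigl => j.
  by rewrite /queried_differ; case: (qidx j) => // i; rewrite eq_sym.
move=> y i; apply: leq_trans (leY y i); rewrite leq_mul2l; apply/orP; right.
by apply: subset_leq_card; apply/subsetP => x; rewrite !inE eq_sym.
Qed.

(** One query gains at most [4 / sqrt (p q)] per related pair on average, while 1/18 has to be
    gained; hence [72 = 4 * 18]. The pair [x0], [y0] ensures [nR > 0]. *)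
Theorem adversary_bound x0 y0 : R x0 y0 ->
  sqrtC ((p * q)%N%:R) / 72 <= T%:R :> C.
Proof.
move=> R0.
have [->|p0] := posnP p; first by rewrite mul0n sqrtC0 mul0r.
have [->|q0] := posnP q; first by rewrite muln0 sqrtC0 mul0r.
have n0 : (0 < nR)%N.
  rewrite /nR (bigD1 x0) //= ltn_addr //.
  by apply/card_gt0P; exists y0; rewrite inE.
pose s : C := sqrtC p%:R; pose s' : C := sqrtC q%:R.
have s0 : 0 < s by rewrite sqrtC_gt0 ltr0n.
have s'0 : 0 < s' by rewrite sqrtC_gt0 ltr0n.
have pE : p%:R = s ^+ 2 by rewrite sqrtCK.
have qE : q%:R = s' ^+ 2 by rewrite sqrtCK.
have sn0 : s != 0 by rewrite gt_eqF.
have s'n0 : s' != 0 by rewrite gt_eqF.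
have PhiT t : Phi t <= t%:R * (4 / (s * s') * nR%:R).
  elim: t => [|t IH].
    rewrite mul0r /Phi big1 // => x _; rewrite big1 // => y _.
    by rewrite subrr /sqnorm big1 // => j _; rewrite mxE normr0 expr0n.
  (* The weight [sqrt p / sqrt q] makes both terms of [Phi_step] equal to [2 / sqrt (p q)]. *)
  apply: le_trans (Phi_step t p0 q0 (divr_gt0 s0 s'0)) _.
  rewrite pE qE -(natr1 t) [leRHS]mulrDl mul1r; apply: lerD => //.
  rewrite le_eqVlt; apply/orP; left; apply/eqP; field.
  by rewrite sn0 s'n0.
have low : nR%:R / 18 <= Phi T.
  rewrite /nR natr_sum mulr_suml; apply: ler_sum => x _.
  rewrite -sum1dep_card natr_sum mulr_suml; apply: ler_sum => y Rxy.
  by case/andP: (fR Rxy); apply: qstate_final.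
have := le_trans low (PhiT T).
have -> : T%:R * (4 / (s * s') * nR%:R) = (72 * T%:R / (s * s')) * (nR%:R / 18) :> C.
  by field; rewrite sn0 s'n0.
rewrite -[leLHS]mul1r ler_pM2r ?divr_gt0 ?ltr0n //.
rewrite ler_pdivlMr ?mulr_gt0 // mul1r => h.
by rewrite natrM sqrtCM ?nnegrE ?ler0n // ler_pdivrMr ?ltr0n // [leRHS]mulrC.
Qed.

End Adversary.

Local Open Scope nat_scope.

(** * Copies of H in graphs with many universal vertices *)

Lemma perm_of_fibers n (U : eqType) (a b : 'I_n -> U) :
  (forall u, #|[set x | a x == u]| = #|[set x | b x == u]|) ->
  exists s : {perm 'I_n}, forall x, b (s x) = a x.
Proof.
move=> ab.
have : perm_eq [tuple a i | i < n] [tuple b i | i < n].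
  apply/allP => u _ /=; rewrite !count_map; apply/eqP.
  have := ab u; rewrite !cardsE !cardE !size_filter => E.
  exact: E.
case/tuple_permP => s E; exists s => x.
have := congr1 (fun t => nth (a x) t x) E.
by rewrite -!tnth_nth !tnth_mktuple.
Qed.

(** Serves to check the hypotheses of [adversary_bound]: [A] holds the relatives of an input, [B]
    those that one edge distinguishes. The size of [A] is needed only when [B] has a member, which
    then shows the shape of the input. *)
Lemma leq_mul_card_sub (Z : finType) (A B : {set Z}) p l :
  B \subset A -> #|B| <= l -> (B != set0 -> p * l <= #|A|) -> p * #|B| <= #|A|.
Proof.
move=> sBA Bl h; have [->|/h h'] := eqVneq B set0; first by rewrite cards0 muln0.
by apply: leq_trans h'; rewrite leq_mul2l Bl orbT.
Qed.

Lemma exists_subset_card (Z : finType) (A : {set Z}) k :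
  k <= #|A| -> exists2 B : {set Z}, B \subset A & #|B| = k.
Proof.
move=> kA; exists [set x in take k (enum A)].
  by apply/subsetP => x; rewrite inE => /mem_take; rewrite mem_enum.
rewrite cardsE; have /card_uniqP -> := take_uniq k (enum_uniq (mem A)).
by rewrite size_take -cardE; case: ltngtP kA.
Qed.

Definition mkgraph n (r : rel 'I_n) : graph n :=
  [ffun e => r (val e).1 (val e).2 || r (val e).2 (val e).1].

Lemma adj_mkgraph n (r : rel 'I_n) u v :
  adj (mkgraph r) u v = (u != v) && (r u v || r v u).
Proof.
rewrite /adj; destruct (@idP (u < v)) as [h|h]; rewrite ?ffunE /=.
  by have -> : u != v by apply: contraTneq h => ->; rewrite ltnn.
destruct (@idP (v < u)) as [h'|h']; rewrite ?ffunE /=.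
  have -> : u != v by apply: contraTneq h' => ->; rewrite ltnn.
  by rewrite orbC.
have -> : u = v by apply: val_inj => /=; lia.
by rewrite eqxx.
Qed.

Lemma adjC n (G : graph n) u v : adj G u v = adj G v u.
Proof.
rewrite /adj; destruct (@idP (u < v)) as [h|h]; destruct (@idP (v < u)) as [h'|h'] => //.
by exfalso; lia.
Qed.

Lemma adj_irr n (G : graph n) u : adj G u u = false.
Proof. by rewrite /adj; destruct (@idP (u < u)) as [h|h] => //; exfalso; lia. Qed.

Lemma f_HP n (H G : graph n) :
  reflect (exists s : {perm 'I_n}, forall u v, adj H u v -> adj G (s u) (s v))
          (f_H H G).
Proof.
apply: (iffP existsP) => -[s hs]; exists s.
  by move=> u v huv; move/forallP/(_ u)/forallP/(_ v)/implyP: hs; apply.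
by apply/forallP => u; apply/forallP => v; apply/implyP; apply: hs.
Qed.

(** A permutation matching the fibres sends each edge of [H] to a pair with the same labels. *)
Lemma f_H_labels n (U : eqType) (a b : 'I_n -> U) (H G : graph n) :
  (forall u, #|[set x | a x == u]| = #|[set x | b x == u]|) ->
  (forall u v u' v', adj H u v -> b u' = a u -> b v' = a v -> u' != v' ->
     adj G u' v') ->
  f_H H G.
Proof.
move=> /perm_of_fibers [s hs] hG; apply/f_HP; exists s => u v huv.
apply: (hG u v) => //; rewrite (inj_eq perm_inj).
by apply: contraTneq huv => ->; rewrite adj_irr.
Qed.

Lemma f_H_mono n (H G G' : graph n) :
  (forall u v, adj G u v -> adj G' u v) -> f_H H G -> f_H H G'.
Proof.
move=> GG' /f_HP [s hs]; apply/f_HP; exists s => u v huv; exact/GG'/hs.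
Qed.

Lemma independentP n (H : graph n) (S : {set 'I_n}) :
  reflect {in S &, forall u v, ~~ adj H u v} (independent H S).
Proof.
apply: (iffP forall_inP) => [h u v uS vS|h u uS].
  by move/forall_inP: (h u uS); apply.
by apply/forall_inP => v vS; apply: h.
Qed.

Lemma leq_alpha n (H : graph n) S : independent H S -> #|S| <= alpha H.
Proof. by move=> hS; apply: (leq_bigmax_cond (F := fun S : {set 'I_n} => #|S|)). Qed.

Lemma alpha_witness n (H : graph n) :
  exists2 S : {set 'I_n}, independent H S & #|S| = alpha H.
Proof.
have h0 : independent H set0 by apply/independentP => u v; rewrite inE.
have [|S hS e] := @eq_bigmax_cond _ (mem [pred S | independent H S]) (fun S : {set 'I_n} => #|S|).
  by apply/card_gt0P; exists set0.
by exists S.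
Qed.

Section FixedGraph.
Variables (n : nat) (H : graph n) (J : {set 'I_n}).
Hypothesis indepJ : independent H J.
Hypothesis cardJ : #|J| = alpha H.

Let cover_card : #|~: J| + alpha H = n.
Proof. by rewrite addnC -cardJ cardsC card_ord. Qed.

(** Every edge of [H] has an end outside the independent set [J], so it suffices to place [~: J] on
    [S]. *)
Lemma f_H_universal (G : graph n) (S : {set 'I_n}) :
  #|S| = #|~: J| ->
  (forall u v, u \in S -> u != v -> adj G u v) -> f_H H G.
Proof.
move=> cS hS; apply: (@f_H_labels _ _ (fun x => x \notin J) (fun x => x \in S)).
  have eT : #|[set x | (x \notin J) == true]| = #|[set x | (x \in S) == true]|.
    have -> : [set x | (x \notin J) == true] = ~: J by apply/setP=> x; rewrite !inE eqb_id.
    by have -> : [set x | (x \in S) == true] = S by apply/setP=> x; rewrite !inE eqb_id.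
  case=> //.
  have cC (a : pred 'I_n) : #|[set x | a x == false]| = n - #|[set x | a x == true]|.
    rewrite cardsCs card_ord; congr (_ - _); apply: eq_card => x.
    by rewrite !inE; case: (a x).
  by rewrite !cC eT.
move=> u v u' v' huv bu bv u'v'.
have [uS|uS] := boolP (u' \in S); first exact: hS.
rewrite adjC; apply: hS; last by rewrite eq_sym.
rewrite bv; move: bu; rewrite (negPf uS) => /esym /negbFE uJ.
by apply: contraL huv => vJ; move/independentP: indepJ; apply.
Qed.

(** The complement of the vertex cover [S] would pull back to an independent set of [H] with more
    than [alpha H] vertices. *)
Lemma not_f_H_cover (G : graph n) (S : {set 'I_n}) :
  #|S| < #|~: J| ->
  (forall u v, adj G u v -> (u \in S) || (v \in S)) -> ~~ f_H H G.
Proof.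
move=> cS hS; apply/negP => /f_HP [s hs].
have : independent H (s @^-1: ~: S).
  apply/independentP => u v; rewrite !inE => uS vS; apply/negP => /hs /hS.
  by rewrite (negPf uS) (negPf vS).
move/leq_alpha; rewrite card_preimset; last exact: perm_inj.
by move: (cardsC S) cover_card; rewrite card_ord; lia.
Qed.

(** [v0] goes to [w], its neighbours in [J] to [D], and the other vertices outside [J] to [S]. The
    only edges of [H] without an end in [~: J :\ v0] join [v0] to those neighbours. *)
Lemma f_H_star (G : graph n) (S D : {set 'I_n}) (w v0 : 'I_n) :
  v0 \notin J -> #|S|.+1 = #|~: J| -> #|D| = #|[set u in J | adj H v0 u]| ->
  w \notin S -> w \notin D -> [disjoint S & D] ->
  (forall u v, u \in S -> u != v -> adj G u v) ->
  (forall u, u \in D -> adj G w u) -> f_H H G.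
Proof.
move=> v0J cS cD wS wD dSD hS hD.
pose lab (S D : {set 'I_n}) w x : nat :=
  if x \in S then 0 else if x == w then 1 else if x \in D then 2 else 3.
set E := [set u in J | adj H v0 u] in cD.
apply: (@f_H_labels _ _ (lab ((~: J) :\ v0) E v0) (lab S D w)).
  have labE (S' D' : {set 'I_n}) w' : w' \notin S' -> w' \notin D' -> [disjoint S' & D'] ->
    forall u, #|[set x | lab S' D' w' x == u]| =
      match u with 0 => #|S'| | 1 => 1 | 2 => #|D'| | 3 => n - (#|S'| + 1 + #|D'|) | _ => 0 end.
    move=> wS' wD' dis u.
    have dd x : x \in S' -> x \in D' = false by move=> xS; apply: disjointFr dis xS.
    have e0 : [set x | lab S' D' w' x == 0] = S'.
      by apply/setP => x; rewrite !inE /lab; repeat case: ifP => ?.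
    have e1 : [set x | lab S' D' w' x == 1] = [set w'].
      apply/setP => x; rewrite !inE /lab; case: (eqVneq x w') => [->|_]; first by rewrite (negPf wS').
      by repeat case: ifP => ?.
    have e2 : [set x | lab S' D' w' x == 2] = D'.
      apply/setP => x; rewrite !inE /lab; case: ifP => [/dd ->//|_].
      by case: (eqVneq x w') => [->|_]; [rewrite (negPf wD')|case: ifP].
    have e3 : [set x | lab S' D' w' x == 3] = ~: (S' :|: [set w'] :|: D').
      by apply/setP => x; rewrite !inE /lab; repeat case: ifP => ?.
    case: u => [|[|[|[|u]]]]; rewrite ?e0 ?e1 ?e2 ?e3 ?cards1 //.
      rewrite cardsCs setCK card_ord !cardsU cards1.
      have -> : S' :&: [set w'] = set0.
        by apply/setP => x; rewrite !inE; case: (eqVneq x w') => [->|]; rewrite ?(negPf wS') ?andbF.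
      have -> : (S' :|: [set w']) :&: D' = set0.
        apply/setP => x; rewrite !inE; case: (boolP (x \in S')) => [/dd ->//|_] /=.
        by case: (eqVneq x w') => [->|]; rewrite ?(negPf wD').
      by rewrite cards0 !subn0.
    by apply/eqP; rewrite cards_eq0; apply/eqP/setP => x; rewrite !inE /lab; repeat case: ifP => ?.
  have cS' : #|(~: J) :\ v0| = #|S|.
    by move: cS; rewrite (cardsD1 v0 (~: J)) inE v0J => -[->].
  move=> u; rewrite !labE //.
  - by case: u => [|[|[|[|u]]]]; rewrite ?cS' ?cD.
  - by rewrite !inE eqxx.
  - by rewrite !inE adj_irr andbF.
  rewrite -setI_eq0; apply/eqP/setP => x; rewrite !inE.
  by case: (x \in J); rewrite ?andbF.
(* As [J] is independent, some end of the edge lies outside [J]; by symmetry it may be taken to be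
   [u]. *)
have key u v u' v' : adj H u v -> lab S D w u' = lab (~: J :\ v0) E v0 u ->
    lab S D w v' = lab (~: J :\ v0) E v0 v -> u' != v' -> u \notin J -> adj G u' v'.
  move=> huv bu bv u'v' uJ.
  have [uv0|uv0] := eqVneq u v0; last first.
    apply: hS => //; move: bu; rewrite {2}/lab !inE uv0 uJ /=.
    by rewrite /lab; repeat case: ifP => ?.
  have u'w : u' = w.
    apply/eqP; move: bu; rewrite {2}/lab uv0 !inE eqxx /= /lab.
    by repeat case: ifP => ?.
  have [vJ|vJ] := boolP (v \in J); last first.
    have vv0 : v != v0 by apply: contraTneq huv => ->; rewrite uv0 adj_irr.
    rewrite adjC; apply: hS; last by rewrite eq_sym.
    move: bv; rewrite {2}/lab !inE vv0 vJ /=.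
    by rewrite /lab; repeat case: ifP => ?.
  have vv0 : v != v0 by apply: contraNneq v0J => <-.
  have vE : v \in E by rewrite inE vJ -uv0.
  rewrite u'w; apply: hD; move: bv; rewrite {2}/lab !inE vJ andbF (negPf vv0) -uv0 huv /=.
  by rewrite /lab; repeat case: ifP => ?.
move=> u v u' v' huv bu bv u'v'.
have [uJ|uJ] := boolP (u \in J); last exact: (key u v).
rewrite adjC; apply: (key v u) => //; rewrite 1?adjC 1?eq_sym //.
by apply: contraL huv => vJ; move/independentP: indepJ; apply.
Qed.

(** * Graphs made of universal vertices only *)

Section Bound.
Variables (C : numClosedFieldType) (T : nat) (A : qalg C (edge n) T).
Hypothesis compA : computes A (f_H H).
Hypothesis cover_gt0 : 0 < #|~: J|.

Lemma bound_cover :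
  (sqrtC ((#|~: J| * uphalf (alpha H))%:R) / 72%:R <= T%:R :> C)%R.
Proof.
pose R (S S' : {set 'I_n}) := (#|S| == #|~: J|) && [exists v in S, S' == S :\ v].
pose xi (S : {set 'I_n}) := mkgraph (fun u _ => u \in S).
have [v0 v0J] : exists v0, v0 \in ~: J by apply/card_gt0P.
apply: (@adversary_bound C _ T A (f_H H) compA _ _ xi xi R _ _ _ _ _ (~: J) (~: J :\ v0)).
- move=> S S' /andP[/eqP cS /exists_inP [v vS /eqP ->]]; apply/andP; split.
    apply: (f_H_universal cS) => a b aS ab.
    by rewrite adj_mkgraph ab aS.
  apply: (@not_f_H_cover _ (S :\ v)).
    by rewrite -cS (cardsD1 v S) vS.
  by move=> a b; rewrite adj_mkgraph => /andP[].
- move=> S e; apply: (@leq_mul_card_sub _ _ _ _ 1).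
  + by apply/subsetP => S'; rewrite !inE => /andP[].
  + apply/card_le1_eqP => S1 S2; rewrite !inE !ffunE.
    case/andP=> /andP[_ /exists_inP [v vS /eqP ->]] hv.
    case/andP=> /andP[_ /exists_inP [v' vS' /eqP ->]].
    (* Removing [z] changes the edge [e] only if [z] is an end of [e] and no other end is in [S];
       this determines [z]. *)
    have claim z : ((val e).1 \in S) || ((val e).2 \in S) !=
        ((val e).1 \in S :\ z) || ((val e).2 \in S :\ z) ->
        (((val e).1 == z) && (((val e).2 \notin S) || ((val e).2 == z))) ||
        (((val e).2 == z) && (((val e).1 \notin S) || ((val e).1 == z))).
      rewrite !inE; case: ((val e).1 == z); case: ((val e).2 == z);
      by case: ((val e).1 \in S); case: ((val e).2 \in S).
    move/claim => hv'; move/claim: hv => hv; congr (S :\ _); move: hv hv'.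
    case/orP => /andP[/eqP <- /orP h1]; case/orP => /andP[/eqP E2 /orP h2] //.
      by case: h1 => [|/eqP <- //]; rewrite E2 vS'.
    by case: h1 => [|/eqP <- //]; rewrite E2 vS'.
  case/set0Pn => S1; rewrite !inE => /andP[/andP[/eqP cS _] _]; rewrite muln1 -cS.
  have <- : #|(fun v => S :\ v) @: S| = #|S|.
    apply: card_in_imset => v v' vS v'S /setP/(_ v'); rewrite !inE v'S eqxx /= andbT.
    by move/negbFE/eqP.
  apply: subset_leq_card; apply/subsetP => S2 /imsetP [v vS ->].
  by rewrite inE /R cS eqxx; apply/exists_inP; exists v.
- move=> S' e; apply: (@leq_mul_card_sub _ _ _ _ 2).
  + by apply/subsetP => S; rewrite !inE => /andP[].
  (* A distinguished relative is [S'] plus an end of [e]: two candidates among [alpha H + 1]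
     extensions, whence [uphalf (alpha H)]. *)
  + apply: (@leq_trans #|[set (val e).1 |: S'; (val e).2 |: S']|); last first.
      by rewrite cards2; case: (_ == _).
    apply: subset_leq_card; apply/subsetP => S; rewrite !inE !ffunE.
    case/andP=> /andP[_ /exists_inP [v vS /eqP ->]]; rewrite !inE.
    have [->|/negPf n1] := eqVneq (val e).1 v; first by rewrite setD1K ?eqxx.
    have [->|/negPf n2] := eqVneq (val e).2 v; first by rewrite (setD1K vS) eqxx orbT.
    by rewrite /= eqxx.
  case/set0Pn => S1; rewrite !inE => /andP[/andP[/eqP cS /exists_inP [v vS /eqP ES']] _].
  have cS' : #|S'|.+1 = #|~: J| by rewrite -cS (cardsD1 v S1) vS ES'.
  apply: (@leq_trans #|(fun v => v |: S') @: (~: S')|); last first.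
    apply: subset_leq_card; apply/subsetP => S2 /imsetP [u /[!inE] uS' ->].
    rewrite /R cardsU1 uS' -cS' eqxx; apply/exists_inP; exists u; first by rewrite !inE eqxx.
    by rewrite setU1K.
  rewrite card_in_imset; last first.
    move=> u u'; rewrite !inE => uS uS' /setP/(_ u); rewrite !inE eqxx /= (negPf uS) orbF.
    by move/esym/eqP.
  by move: (cardsC S') cover_card; rewrite card_ord; lia.
by rewrite /R eqxx; apply/exists_inP; exists v0.
Qed.

End Bound.
End FixedGraph.

(** * Dense stars *)

Section Dense.
Variables (n : nat) (H : graph n) (J : {set 'I_n}).
Hypothesis indepJ : independent H J.
Hypothesis cardJ : #|J| = alpha H.
Variables (C : numClosedFieldType) (T : nat) (A : qalg C (edge n) T).
Hypothesis compA : computes A (f_H H).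
Variable v0 : 'I_n.
Hypothesis v0J : v0 \notin J.
Let d := #|[set u in J | adj H v0 u]|.
Hypothesis d_min : forall v, v \notin J -> d <= #|[set u in J | adj H v u]|.
Variable M : nat.
Hypothesis M_gt0 : 0 < M.
Hypothesis M_lt : #|~: J| + M <= d.

Let cover_card : #|~: J| + alpha H = n.
Proof. by rewrite addnC -cardJ cardsC card_ord. Qed.

Let d_le : d <= alpha H.
Proof. by rewrite -cardJ; apply: subset_leq_card; apply/subsetP => x; rewrite inE => /andP[]. Qed.

Variables S V1 : {set 'I_n}.
Hypothesis cardS : #|S|.+1 = #|~: J|.
Hypothesis cardV1 : #|V1| = M.
Hypothesis disSV1 : [disjoint S & V1].
Let V2 := ~: (S :|: V1).

Let cardV2 : #|V2| = (alpha H).+1 - M.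
Proof.
rewrite /V2 cardsCs setCK card_ord cardsU cardV1.
have -> : S :&: V1 = set0 by apply/eqP; rewrite setI_eq0.
by rewrite cards0; move: cover_card cardS; lia.
Qed.

Definition dense_graph (Z : {set 'I_n * 'I_n}) : graph n :=
  mkgraph (fun u v => [|| u \in S, (u \in V1) && (v \in V1) | (u, v) \in Z]).

Definition row_set (Z : {set 'I_n * 'I_n}) (w : 'I_n) := [set u | (w, u) \in Z].

(** Together with the other [M - 1] vertices of the clique [V1], such a row gives each [w] in [V1]
    exactly [d - 1] neighbours outside [S], one short of the star that completes [H]. *)
Definition row_regular (Z : {set 'I_n * 'I_n}) :=
  (Z \subset setX V1 V2) && [forall w in V1, #|row_set Z w| == d - M].

Let inV2 u : (u \in V2) = (u \notin S) && (u \notin V1).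
Proof. by rewrite /V2 !inE negb_or. Qed.

Lemma row_set_sub (Z : {set 'I_n * 'I_n}) w : Z \subset setX V1 V2 -> row_set Z w \subset V2.
Proof. by move=> /subsetP sZ; apply/subsetP => u; rewrite inE => /sZ; rewrite inE => /andP[]. Qed.

Lemma dense_graph0 Z : row_regular Z -> ~~ f_H H (dense_graph Z).
Proof.
case/andP=> sZ /forall_inP rZ; apply/negP => /f_HP [s hs].
have sinj := @perm_inj _ s.
(* A vertex of [V2] has at most [|S| + M < d] neighbours, too few for the image of a vertex outside
   [J]. *)
have inV1 v : v \notin J -> s v \in S :|: V1.
  move=> vJ; apply: contraTT (d_min vJ) => sv; rewrite -ltnNge.
  have svV2 : s v \in V2 by rewrite /V2 inE.
  rewrite -(card_imset _ sinj).
  apply: (@leq_ltn_trans #|S :|: V1|); last first.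
    by rewrite cardsU cardV1; move: cardS M_lt; lia.
  apply: subset_leq_card; apply/subsetP => x /imsetP [u]; rewrite inE => /andP[_ /hs h] ->.
  move: h; rewrite adj_mkgraph => /andP[_]; move: svV2; rewrite inV2 inE => /andP[/negPf -> /negPf sV1].
  rewrite sV1 !andbF /=; case: (s u \in S) => //= /orP[h|h].
    by move/subsetP/(_ _ h): sZ; rewrite inE /= sV1.
  by move/subsetP/(_ _ h): sZ; rewrite inE /= => /andP[->].
(* [S] has one vertex fewer than [~: J]. *)
have [v vJ sv] : exists2 v, v \notin J & s v \in V1.
  have [/subsetP h|/subsetPn [v]] := boolP (s @: (~: J) \subset S).
    have : #|s @: (~: J)| <= #|S| by apply: subset_leq_card; apply/subsetP.
    by rewrite (card_imset _ sinj) -cardS ltnn.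
  case/imsetP => v' /[!inE] v'J -> svS; exists v' => //.
  by have := inV1 _ v'J; rewrite inE (negPf svS).
(* The images of the vertices outside J lie in the clique S :|: V1, so all but one of
   them are among the |S| + d - 1 neighbours of s v, leaving d - 1 for J. *)
pose B := (~: J :\ v) :|: [set u in J | adj H v u].
have cB : #|S| + d <= #|B|.
  rewrite /B cardsU.
  have -> : (~: J :\ v) :&: [set u in J | adj H v u] = set0.
    by apply/setP => x; rewrite !inE; case: (x \in J); rewrite ?andbF.
  rewrite cards0 subn0; apply: leq_add; last exact: d_min.
  by move: cardS; rewrite (cardsD1 v (~: J)) inE vJ => -[->].
have : s @: B \subset S :|: (V1 :\ s v) :|: row_set Z (s v).
  apply/subsetP => x /imsetP [u uB ->]; move: uB; rewrite !inE => /orP[/andP[uv uJ]|/andP[uJ /hs]].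
    by have := inV1 _ uJ; rewrite inE (inj_eq sinj) uv => ->.
  rewrite adj_mkgraph => /andP[nuv]; rewrite sv /= eq_sym nuv /=.
  have -> /= : s v \in S = false by apply: disjointFl disSV1 sv.
  case: (s u \in S) => //=; case: (s u \in V1) => //=.
  case/orP => // h; move/subsetP/(_ _ h): sZ; rewrite !inE /= sv.
  by rewrite orbT andbF.
move/subset_leq_card; rewrite (card_imset _ sinj).
move: (rZ _ sv) => /eqP rv.
have c1 : #|V1 :\ s v|.+1 = M by rewrite -cardV1 (cardsD1 (s v) V1) sv.
have := leq_subr #|S :&: (V1 :\ s v)| (#|S| + #|V1 :\ s v|).
have := leq_subr #|(S :|: (V1 :\ s v)) :&: row_set Z (s v)| (#|S :|: (V1 :\ s v)| + #|row_set Z (s v)|).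
by rewrite -!cardsU rv; move: M_lt; lia.
Qed.

(** The end of [e] in [V1] now has [(M - 1) + (d - M + 1) = d] neighbours outside [S] and can be the
    centre in [f_H_star]. *)
Lemma dense_graph1 (Z : {set 'I_n * 'I_n}) e : row_regular Z -> e \in setX V1 V2 :\: Z ->
  f_H H (dense_graph (e |: Z)).
Proof.
case: e => w u /andP[sZ /forall_inP rZ]; rewrite !inE /= => /andP[uZ /andP[wV1 uV2]].
have uV2' : u \in V2 by rewrite !inE.
have wS : w \notin S by rewrite (disjointFl disSV1 wV1).
have sub := row_set_sub w sZ.
apply: (@f_H_star _ _ _ indepJ _ S ((V1 :\ w) :|: (u |: row_set Z w)) w v0) => //.
- rewrite cardsU cardsU1 inE uZ (eqP (rZ _ wV1)).
  have -> : (V1 :\ w) :&: (u |: row_set Z w) = set0.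
    apply/setP => x; rewrite [RHS]inE; apply/negbTE/negP; rewrite !inE.
    case/andP=> /andP[_ xV1] /orP[/eqP xu|xZ]; first by move: uV2' ; rewrite inV2 -xu xV1 andbF.
    by move/subsetP: sub => /(_ x); rewrite inE => /(_ xZ); rewrite inV2 xV1 andbF.
  have cw : #|V1 :\ w|.+1 = M by rewrite -cardV1 (cardsD1 w V1) wV1.
  rewrite cards0 subn0 -/d add1n addnS -addSn cw subnKC //.
  exact: leq_trans (leq_addl _ _) M_lt.
- rewrite !inE eqxx /=; apply/norP; split.
    by apply: contraTneq uV2' => <-; rewrite inV2 wV1 andbF.
  apply/negP => h; move/subsetP: sub => /(_ w); rewrite inE => /(_ h); by rewrite inV2 wV1 andbF.
- rewrite -setI_eq0; apply/eqP/setP => x; rewrite [RHS]inE; apply/negbTE/negP; rewrite !inE.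
  case/andP=> xS /orP[/andP[_ xV1]|/orP[/eqP xu|xZ]].
  + by move: (disjointFr disSV1 xS); rewrite xV1.
  + by move: uV2'; rewrite inV2 -xu xS.
  + by move/subsetP: sub => /(_ x); rewrite inE => /(_ xZ); rewrite inV2 xS.
- by move=> a b aS ab; rewrite adj_mkgraph ab aS.
move=> x; rewrite !inE adj_mkgraph !inE wV1 => /orP[/andP[xw xV1]|/orP[/eqP ->|xZ]].
- by rewrite eq_sym xw xV1 /= orbT.
- by rewrite eqxx !orbT orTb andbT; apply: contraTneq uV2' => <-; rewrite inV2 wV1 andbF.
- rewrite xZ !orbT orTb andbT; apply: contraTneq xZ => <-; apply/negP => h.
  by move/subsetP: sub => /(_ w); rewrite inE => /(_ h); rewrite inV2 wV1 andbF.
Qed.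

Lemma card_row_regular Z : row_regular Z -> #|Z| = M * (d - M).
Proof.
case/andP=> /subsetP sZ /forall_inP rZ.
have -> : #|Z| = \sum_(w in V1) #|row_set Z w|.
  under eq_bigr => w wV1 do rewrite -sum1dep_card.
  rewrite pair_big_dep /= -sum1_card; apply: eq_bigl => -[w u] /=.
  by case: (boolP ((w, u) \in Z)) => [/sZ|]; rewrite ?andbF // inE /= => /andP[->].
by rewrite (eq_bigr _ (fun w hw => eqP (rZ w hw))) sum_nat_const cardV1.
Qed.

(** Only the edge underlying [e] can change, and its end in [V1] recovers the orientation. *)
Lemma dense_differ (Z : {set 'I_n * 'I_n}) e (ed : edge n) : e \in setX V1 V2 ->
  dense_graph (e |: Z) ed != dense_graph Z ed ->
  e = if (val ed).1 \in V1 then val ed else ((val ed).2, (val ed).1).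
Proof.
case: e => w u eX; rewrite !ffunE; case: (val ed) => a b.
move: eX; rewrite inE /= => /andP[wV1]; rewrite inV2 => /andP[_ uV1]; rewrite !inE.
have [[-> ->]|n1] := eqVneq (a, b) (w, u); first by rewrite wV1.
have [[-> ->]|n2] := eqVneq (b, a) (w, u); first by rewrite (negPf uV1).
by rewrite /= eqxx.
Qed.

(** The first factor counts the pairs removable from the overfull row, the second the absent pairs
    of [setX V1 V2], namely [M * (alpha H + 1 - M) - M * (d - M)]. *)
Lemma bound_dense_partition :
  (sqrtC (((d - M).+1 * (M * ((alpha H).+1 - d)))%:R) / 72%:R <= T%:R :> C)%R.
Proof.
pose R (Z Z' : {set 'I_n * 'I_n}) :=
  row_regular Z' && [exists e in setX V1 V2 :\: Z', Z == e |: Z'].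
have RP Z Z' : R Z Z' -> [/\ row_regular Z' & exists2 e, e \in setX V1 V2 :\: Z' & Z = e |: Z'].
  by case/andP=> r /exists_inP [e he /eqP]; split=> //; exists e.
have cU Z : row_regular Z -> #|setX V1 V2 :\: Z| = M * ((alpha H).+1 - d).
  move=> rZ; rewrite cardsD cardsX (setIidPr _); last by case/andP: rZ.
  by rewrite (card_row_regular rZ) cardV1 cardV2 -mulnBr; congr (_ * _); move: M_lt d_le; lia.
have [Z0 rZ0] : exists Z0, row_regular Z0.
  have [D sD cD] : exists2 D : {set 'I_n}, D \subset V2 & #|D| = d - M.
    by apply: exists_subset_card; rewrite cardV2; move: d_le; lia.
  exists (setX V1 D); rewrite /row_regular setXS //=; apply/forall_inP => w wV1.
  by rewrite -cD; apply/eqP; apply: eq_card => u; rewrite !inE /= wV1.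
have [e0 he0] : exists e0, e0 \in setX V1 V2 :\: Z0.
  by apply/card_gt0P; rewrite (cU _ rZ0) muln_gt0 M_gt0; move: d_le; lia.
apply: (@adversary_bound C _ T A (f_H H) compA _ _ dense_graph dense_graph R _ _ _ _ _ (e0 |: Z0) Z0).
- move=> Z Z' /RP [rZ' [e he ->]].
  by rewrite dense_graph1 // dense_graph0.
- move=> Z ed; apply: (@leq_mul_card_sub _ _ _ _ 1).
  + by apply/subsetP => Z'; rewrite !inE => /andP[].
  + apply/card_le1_eqP => Z1 Z2; rewrite !inE.
    case/andP=> /RP [r1 [e1 h1 E1]] d1 /andP [/RP [r2 [e2 h2 E2]] d2].
    have h1' : e1 \in setX V1 V2 by case/setDP: h1.
    have h2' : e2 \in setX V1 V2 by case/setDP: h2.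
    rewrite {1}E1 in d1; rewrite {1}E2 in d2.
    have e12 : e1 = e2 by rewrite (dense_differ h1' d1) (dense_differ h2' d2).
    have -> : Z1 = Z :\ e1 by rewrite E1 setU1K //; case/setDP: h1.
    have -> : Z2 = Z :\ e2 by rewrite E2 setU1K //; case/setDP: h2.
    by rewrite e12.
  case/set0Pn => Z1; rewrite !inE => /andP[/RP [r1 [[w u] h1 E1]] _]; rewrite muln1.
  have /setDP[] := h1; rewrite inE /= => /andP[wV1 uV2] uZ1.
  have /andP[sZ1 /forall_inP rZ1] := r1.
  (* Row [w] has one pair too many, and deleting any of its pairs restores regularity. *)
  have cw : #|row_set Z w| = (d - M).+1.
    have -> : row_set Z w = u |: row_set Z1 w.
      by apply/setP => x; rewrite E1 !inE xpair_eqE eqxx.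
    by rewrite cardsU1 inE uZ1 (eqP (rZ1 _ wV1)).
  rewrite -cw.
  have <- : #|(fun x => Z :\ (w, x)) @: row_set Z w| = #|row_set Z w|.
    apply: card_in_imset => x x' /[!inE] xZ x'Z /setP/(_ (w, x')).
    by rewrite !inE x'Z eqxx andbT /= xpair_eqE eqxx => /negbFE/eqP.
  apply: subset_leq_card; apply/subsetP => Z2 /imsetP [x xZ ->].
  rewrite inE in xZ.
  have sZ : Z \subset setX V1 V2.
    by rewrite E1 subUset sZ1 andbT sub1set; case/setDP: h1.
  rewrite inE /R; apply/andP; split; last first.
    apply/exists_inP; exists (w, x); last by rewrite setD1K.
    by rewrite !inE /= !eqxx /=; have := subsetP sZ _ xZ; rewrite !inE.
  apply/andP; split; first by apply: subset_trans sZ; apply: subD1set.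
  apply/forall_inP => w' w'V1.
  have [->|nw] := eqVneq w' w.
    rewrite (cardsD1 x) inE xZ in cw.
    case: cw => <-; apply/eqP; apply: eq_card => y.
    by rewrite !inE xpair_eqE eqxx.
  rewrite -(eqP (rZ1 _ w'V1)); apply/eqP; apply: eq_card => y.
  by rewrite E1 !inE !xpair_eqE (negPf nw).
- move=> Z' ed; apply: (@leq_mul_card_sub _ _ _ _ 1).
  + by apply/subsetP => Z; rewrite !inE => /andP[].
  + apply/card_le1_eqP => Z1 Z2; rewrite !inE.
    case/andP=> /RP [r1 [e1 h1 ->]] d1 /andP [/RP [r2 [e2 h2 ->]] d2].
    have h1' : e1 \in setX V1 V2 by case/setDP: h1.
    have h2' : e2 \in setX V1 V2 by case/setDP: h2.
    by rewrite (dense_differ h1' d1) (dense_differ h2' d2).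
  case/set0Pn => Z1; rewrite !inE => /andP[/RP [r1 _] _]; rewrite muln1 -(cU _ r1).
  have <- : #|(fun e => e |: Z') @: (setX V1 V2 :\: Z')| = #|setX V1 V2 :\: Z'|.
    apply: card_in_imset => e e' /setDP[_ eZ] _ /setP/(_ e).
    by rewrite !inE eqxx (negPf eZ) !orbF => /esym/eqP.
  apply: subset_leq_card; apply/subsetP => Z2 /imsetP [e he ->].
  by rewrite inE /R r1; apply/exists_inP; exists e.
by rewrite /R rZ0; apply/exists_inP; exists e0.
Qed.

End Dense.

Section DenseBound.
Variables (n : nat) (H : graph n) (J : {set 'I_n}).
Hypothesis indepJ : independent H J.
Hypothesis cardJ : #|J| = alpha H.
Variables (C : numClosedFieldType) (T : nat) (A : qalg C (edge n) T).
Hypothesis compA : computes A (f_H H).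

Lemma bound_dense v0 M :
  let d := #|[set u in J | adj H v0 u]| in
  v0 \notin J -> (forall v, v \notin J -> d <= #|[set u in J | adj H v u]|) ->
  0 < M -> #|~: J| + M <= d ->
  (sqrtC (((d - M).+1 * (M * ((alpha H).+1 - d)))%:R) / 72%:R <= T%:R :> C)%R.
Proof.
move=> d v0J d_min M0 M_lt.
have d_le : d <= alpha H.
  by rewrite -cardJ; apply: subset_leq_card; apply/subsetP => x; rewrite inE => /andP[].
have [V1 sV1 cV1] : exists2 V1 : {set 'I_n}, V1 \subset J & #|V1| = M.
  by apply: exists_subset_card; rewrite cardJ; lia.
apply: (@bound_dense_partition _ _ _ indepJ cardJ _ _ _ compA v0 v0J d_min M M0 M_lt (~: J :\ v0) V1) => //.
  by rewrite (cardsD1 v0 (~: J)) inE v0J.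
rewrite -setI_eq0; apply/eqP/setP => x; rewrite !inE.
by case: (boolP (x \in V1)) => [/(subsetP sV1) ->|_]; rewrite ?andbF.
Qed.
End DenseBound.

(** * Star forests *)

Lemma exists_fibers n (U : finType) (kappa : U -> nat) :
  \sum_a kappa a = n ->
  exists l : {ffun 'I_n -> U}, forall a, #|[set v | l v == a]| = kappa a.
Proof.
move=> sk; pose s := flatten [seq nseq (kappa a) a | a <- enum U].
have ss : size s == n.
  rewrite size_flatten /shape -map_comp sumnE big_map big_enum -sk /=.
  by apply/eqP/eq_bigr => a _; rewrite size_nseq.
exists [ffun v => tnth (Tuple ss) v] => a.
have -> : kappa a = count_mem a s.
  rewrite count_flatten -map_comp sumnE big_map big_enum (bigD1 a) //=.
  rewrite count_nseq /= eqxx mul1n big1 ?addn0 // => b /negPf ba.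
  by rewrite count_nseq /= ba.
have -> : count_mem a s = count_mem a (map (tnth (Tuple ss)) (enum 'I_n)).
  by rewrite map_tnth_enum.
rewrite count_map cardsE cardE size_filter enumT.
by apply: eq_count => v; rewrite /= unfold_in /= ffunE.
Qed.

Section StarForests.
Variables (n M : nat).

(* inl true marks a universal vertex, inl false a free one, inr (inl c) the
   centre and inr (inr c) a leaf of the c-th star. *)
Definition label := (bool + ('I_M + 'I_M))%type.
Definition uS : label := inl true.
Definition uF : label := inl false.
Definition uC (c : 'I_M) : label := inr (inl c).
Definition uL (c : 'I_M) : label := inr (inr c).

Definition label_adj (a b : label) : bool :=
  match a, b with
  | inl true, _ => true
  | inr (inl c), inr (inr c') => c == c'
  | _, _ => false
  end.

Implicit Types x y l : {ffun 'I_n -> label}.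

Definition star_graph l : graph n := mkgraph (fun u v => label_adj (l u) (l v)).

Definition cnt l a := #|[set v | l v == a]|.

Lemma cntE l a : cnt l a = \sum_v (l v == a).
Proof. by rewrite /cnt -sum1dep_card big_mkcond; apply: eq_bigr => v _; case: eqP. Qed.

Lemma sum_cnt l : \sum_a cnt l a = n.
Proof.
under eq_bigr => a _ do rewrite cntE.
rewrite exchange_big /= -[RHS]card_ord -sum1_card; apply: eq_bigr => v _.
by rewrite (bigD1 (l v)) //= eqxx big1 ?addn0 // => a; rewrite eq_sym => /negPf ->.
Qed.

Lemma sum_label (F : label -> nat) :
  \sum_a F a = F uS + F uF + (\sum_c F (uC c) + \sum_c F (uL c)).
Proof. by rewrite big_sumType big_bool big_sumType. Qed.

Definition upd l v a : {ffun 'I_n -> label} := [ffun u => if u == v then a else l u].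

Lemma cnt_upd l v a b : cnt (upd l v a) b + (l v == b) = cnt l b + (a == b).
Proof.
rewrite !cntE (bigD1 v) //= [X in _ = X + _](bigD1 v) //= ffunE eqxx.
rewrite (eq_bigr (fun u => (l u == b) : nat)); first by rewrite addnC [RHS]addnAC addnA.
by move=> u /negPf uv; rewrite ffunE uv.
Qed.

Lemma upd_upd l v a : upd (upd l v a) v (l v) = l.
Proof. by apply/ffunP => u; rewrite !ffunE; case: eqP => // ->. Qed.

Variable t : nat.

(** All [M] stars have a centre, even those without leaves, so that forests with different leaf
    numbers share one label type. *)
Definition star_labelling l := (cnt l uS == t) && [forall c, cnt l (uC c) == 1].

Definition relabel (b : {perm 'I_M}) (a : label) : label :=
  match a with
  | inl z => inl z
  | inr (inl c) => uC (b c)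
  | inr (inr c) => uL (b c)
  end.

Lemma relabel_inj b : injective (relabel b).
Proof. by case=> [z|[c|c]] [z'|[c'|c']] //= [] // /perm_inj ->. Qed.

Lemma label_adj_relabel b a a' : label_adj (relabel b a) (relabel b a') = label_adj a a'.
Proof. by case: a => [[]|[c|c]]; case: a' => [[]|[c'|c']] //=; rewrite (inj_eq perm_inj). Qed.

(** After the stars are renamed by [b], every label has the same number of vertices on both sides;
    for the free label this follows from the total [n]. *)
Lemma star_graph_iso (H : graph n) l l' (b : {perm 'I_M}) :
  star_labelling l -> star_labelling l' ->
  (forall c, cnt l' (uL (b c)) = cnt l (uL c)) ->
  f_H H (star_graph l) -> f_H H (star_graph l').
Proof.
case/andP=> /eqP lS /forallP lC /andP[/eqP l'S /forallP l'C] degE.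
pose lb := [ffun v => relabel b (l v)].
have cb a : cnt lb (relabel b a) = cnt l a.
  by rewrite /cnt; apply: eq_card => v; rewrite !inE ffunE (inj_eq (@relabel_inj b)).
have eS : cnt lb uS = cnt l' uS by rewrite (cb uS) lS l'S.
have eC c : cnt lb (uC c) = cnt l' (uC c).
  by have := cb (uC ((b^-1)%g c)); rewrite /= permKV => ->; rewrite (eqP (lC _)) (eqP (l'C _)).
have eL c : cnt lb (uL c) = cnt l' (uL c).
  by have := cb (uL ((b^-1)%g c)); rewrite /= permKV => ->; rewrite -degE permKV.
have eF : cnt lb uF = cnt l' uF.
  have := sum_cnt lb; rewrite -(sum_cnt l') !sum_label eS.
  rewrite (eq_bigr _ (fun c _ => eC c)) (eq_bigr (fun c => cnt l' (uL c)) (fun c _ => eL c)).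
  by move=> /addIn /addnI.
have [|s hs] := @perm_of_fibers n _ lb l'.
  by move=> a; case: a => [[]|[c|c]]; [exact: eS|exact: eF|exact: eC|exact: eL].
move=> /f_HP [s0 hs0]; apply/f_HP; exists (s0 * s)%g => u v /hs0.
rewrite !adj_mkgraph !permM !(inj_eq perm_inj) !hs !ffunE.
by rewrite !label_adj_relabel.
Qed.

Variables (k m : nat).

Definition top l := [set c | cnt l (uL c) == k].
Definition active := [set c : 'I_M | c < m].

(** Level [j] in turning [m] stars with [k - 1] leaves into stars with [k] leaves, one at a time. *)
Definition stars j l :=
  [&& star_labelling l,
      [forall c, if c \in active then (cnt l (uL c) == k) || ((cnt l (uL c)).+1 == k)
                 else cnt l (uL c) == 0]
    & #|top l| == j].

Hypothesis k_gt0 : 0 < k.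

Lemma starsP j l : stars j l ->
  [/\ star_labelling l, #|top l| = j, top l \subset active,
      (forall c, c \in active -> c \notin top l -> (cnt l (uL c)).+1 = k) &
      forall c, c \notin active -> cnt l (uL c) = 0].
Proof.
case/and3P=> st /forallP h /eqP tj; split=> //.
- apply/subsetP => c; rewrite inE => /eqP ck; have := h c; case: (c \in active) => //.
  by rewrite ck => /eqP k0; move: k_gt0; rewrite k0.
- by move=> c ca; rewrite inE => nk; have := h c; rewrite ca (negPf nk) /= => /eqP.
- by move=> c ca; have := h c; rewrite (negPf ca) => /eqP.
Qed.

(** Being active and being in [top] determine the number of leaves of a star, so it is enough to
    match these two bits. Hence containing [H] depends only on the level. *)
Lemma stars_iso (H : graph n) j l l' : stars j l -> stars j l' ->
  f_H H (star_graph l) -> f_H H (star_graph l').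
Proof.
case/starsP=> st tj ta d1 d0; case/starsP=> st' tj' ta' d1' d0'.
pose key (x : {ffun 'I_n -> label}) (c : 'I_M) := (c \in active, c \in top x).
have cards (x : {ffun 'I_n -> label}) z : #|top x| = j -> top x \subset active ->
    #|[set c | key x c == z]| = match z with
      (true, true) => j | (true, false) => #|active| - j
      | (false, true) => 0 | _ => #|~: active| end.
  move=> tx tax; have sub := subsetP tax.
  case: z => [[] []].
  - rewrite -tx; apply: eq_card => c; rewrite inE /key xpair_eqE !eqb_id.
    by case: (boolP (c \in top x)) => [/sub ->|]; rewrite ?andbF.
  - rewrite -tx -(setIidPr tax) -cardsD; apply: eq_card => c.
    by rewrite in_setD inE /key xpair_eqE eqb_id eqbF_neg andbC.
  - apply/eqP; rewrite cards_eq0; apply/eqP/setP => c; rewrite inE /key xpair_eqE [RHS]inE eqbF_neg eqb_id.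
    by case: (boolP (c \in top x)) => [/sub ->|]; rewrite ?andbF.
  - apply: eq_card => c; rewrite in_setC inE /key xpair_eqE !eqbF_neg.
    by case: (boolP (c \in top x)) => [/sub ->|]; rewrite ?andbT.
have [|b hb] := @perm_of_fibers M _ (key l) (key l').
  by move=> z; rewrite !cards.
apply: (@star_graph_iso H l l' b) => // c.
have [ea et] := hb c.
have [ca|ca] := boolP (c \in active); last first.
  by rewrite d0 // d0' // ea.
have [ct|ct] := boolP (c \in top l).
  by move: (ct); rewrite -et !inE => /eqP ->; move: ct; rewrite inE => /eqP ->.
by apply: succn_inj; rewrite d1 // d1' // ?ea ?et.
Qed.

Lemma star_labelling_upd l v a c : l v \in [:: uF; uL c] -> a \in [:: uF; uL c] ->
  star_labelling l -> star_labelling (upd l v a).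
Proof.
move=> lv av /andP[/eqP lS /forallP lC].
have key b : b != uF -> b != uL c -> cnt (upd l v a) b = cnt l b.
  move=> bF bL; have := cnt_upd l v a b.
  have -> : (l v == b) = false.
    by apply: contraTF lv => /eqP ->; rewrite !inE negb_or bF.
  have -> : (a == b) = false.
    by apply: contraTF av => /eqP ->; rewrite !inE negb_or bF.
  by rewrite !addn0.
apply/andP; split; first by rewrite key // lS.
by apply/forallP => c'; rewrite key.
Qed.

Lemma stars_down j x v c : stars j.+1 x -> x v = uL c -> c \in top x ->
  stars j (upd x v uF).
Proof.
case/starsP=> st tj ta d1 d0 xv ct.
have cE c' : cnt (upd x v uF) (uL c') + (c' == c) = cnt x (uL c').
  have := cnt_upd x v uF (uL c'); rewrite xv addn0 => <-; congr (_ + nat_of_bool _).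
  by rewrite eq_sym.
have ck : cnt x (uL c) = k by move: ct; rewrite inE => /eqP.
have topE : top (upd x v uF) = top x :\ c.
  apply/setP => c'; rewrite !inE; have := cE c'.
  case: eqP => [->|_]; last by rewrite addn0 => ->.
  by rewrite ck /= => <-; rewrite addn1; apply/negbTE; lia.
apply/and3P; split.
- by apply: (@star_labelling_upd _ _ _ c); rewrite ?xv ?inE ?eqxx ?orbT.
- apply/forallP => c'; have := cE c'; case: (eqVneq c' c) => [->|cc].
    by rewrite (subsetP ta _ ct) ck => <-; rewrite addn1 eqxx orbT.
  rewrite addn0 => ->; case: ifP => ca; last by rewrite d0 // ca.
  have [ct'|ct'] := boolP (c' \in top x); first by move: ct'; rewrite inE => ->.
  by rewrite d1 // eqxx orbT.
- by rewrite topE; move: tj; rewrite (cardsD1 c) ct add1n => -[->].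
Qed.

Lemma stars_up j y v c : stars j y -> y v = uF -> c \in active :\: top y ->
  stars j.+1 (upd y v (uL c)).
Proof.
case/starsP=> st tj ta d1 d0 yv /setDP[ca ct].
have cE c' : cnt (upd y v (uL c)) (uL c') = cnt y (uL c') + (c' == c).
  have := cnt_upd y v (uL c) (uL c'); rewrite yv addn0 => ->; congr (_ + nat_of_bool _).
  by rewrite eq_sym.
have ck : (cnt y (uL c)).+1 = k by apply: d1.
have topE : top (upd y v (uL c)) = c |: top y.
  apply/setP => c'; rewrite !inE cE.
  by case: (eqVneq c' c) => [->|_] /=; rewrite ?addn1 ?ck ?eqxx ?addn0.
apply/and3P; split.
- by apply: (@star_labelling_upd _ _ _ c); rewrite ?yv ?inE ?eqxx ?orbT.
- apply/forallP => c'; rewrite cE; case: (eqVneq c' c) => [->|cc].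
    by rewrite ca addn1 ck eqxx.
  rewrite addn0; case: ifP => ca'; last by rewrite d0 // ca'.
  have [ct'|ct'] := boolP (c' \in top y); first by move: ct'; rewrite inE => ->.
  by rewrite d1 // eqxx orbT.
- by rewrite topE cardsU1 ct tj.
Qed.

(** A free vertex and a leaf of star [c] differ only in their adjacency to the centre, so a
    distinguishing edge reveals both [v] and [c]. *)
Lemma star_differ l v c (e : edge n) : l v = uF ->
  star_graph (upd l v (uL c)) e != star_graph l e ->
  ((val e).1 == v) && (l (val e).2 == uC c) || ((val e).2 == v) && (l (val e).1 == uC c).
Proof.
move=> lv; rewrite !ffunE; case: (val e) => a b /=.
case: (eqVneq a v) => [->|_]; case: (eqVneq b v) => [->|_]; rewrite ?lv /= ?orbF ?eqxx //=.
- by case: (l b) => [[]|[c'|c']] //=; case: (eqVneq c' c) => // ->; rewrite eqxx.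
- by case: (l a) => [[]|[c'|c']] //=; case: (eqVneq c' c) => // ->; rewrite eqxx.
Qed.

End StarForests.

(** * The adversary bound between two consecutive levels *)

Section StarBound.
Variables (n : nat) (H : graph n).
Variables (C : numClosedFieldType) (T : nat) (A : qalg C (edge n) T).
Hypothesis compA : computes A (f_H H).

(** Downwards, any of the [j.+1 * k] leaves of the stars in [top] can be freed; upwards, any short
    active star can take any of at least [F] free vertices. An edge distinguishes at most one
    relative on either side. *)
Lemma bound_stars M t k m j F (x0 : {ffun 'I_n -> label M}) : 0 < k ->
  stars t k m j.+1 x0 -> f_H H (star_graph x0) ->
  (forall y : {ffun 'I_n -> label M}, stars t k m j y ->
     ~~ f_H H (star_graph y) && (F <= cnt y (uF M))) ->
  (sqrtC ((j.+1 * k * ((#|active M m| - j) * F))%:R) / 72%:R <= T%:R :> C)%R.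
Proof.
move=> k0 hx0 fx0 hy.
pose R (x y : {ffun 'I_n -> label M}) := stars t k m j.+1 x &&
  [exists v, [exists c in top k x, (x v == uL c) && (y == upd x v (uF M))]].
have RP x y : R x y -> exists v c, [/\ stars t k m j.+1 x, c \in top k x, x v = uL c & y = upd x v (uF M)].
  by case/andP=> st /existsP [v /exists_inP [c ct /andP[/eqP xv /eqP yE]]]; exists v, c.
have RI x v c : stars t k m j.+1 x -> c \in top k x -> x v = uL c -> R x (upd x v (uF M)).
  move=> st ct xv; rewrite /R st; apply/existsP; exists v; apply/exists_inP.
  by exists c => //; rewrite xv !eqxx.
have diffx (x : {ffun 'I_n -> label M}) v c (e : edge n) : x v = uL c ->
   star_graph x e != star_graph (upd x v (uF M)) e ->
   ((val e).1 == v) && (x (val e).2 == uC c) || ((val e).2 == v) && (x (val e).1 == uC c).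
  move=> xv; have := @star_differ _ _ (upd x v (uF M)) v c e.
  have -> : upd (upd x v (uF M)) v (uL c) = x by rewrite -xv upd_upd.
  rewrite ffunE eqxx => h /(h erefl); rewrite !ffunE.
  by case: ifP => [/eqP ->|_]; case: ifP => [/eqP ->|_]; rewrite ?andbF ?orbF.
have cleaves (x : {ffun 'I_n -> label M}) : stars t k m j.+1 x ->
    #|[set v | [exists c in top k x, x v == uL c]]| = j.+1 * k.
  case/(starsP k0) => _ tj _ _ _.
  rewrite -tj -sum_nat_const.
  rewrite [RHS](eq_bigr (fun c => \sum_v (x v == uL c))); last first.
    by move=> c; rewrite inE => /eqP {1}<-; rewrite cntE.
  rewrite exchange_big /= -sum1dep_card big_mkcond /=; apply: eq_bigr => v _.
  case: exists_inP => [[c ct /eqP xv]|nex].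
    rewrite (bigD1 c) //= xv eqxx big1 // => c' /andP[_ /negPf nc].
    by case: eqP => // -[] e; rewrite e eqxx in nc.
  by rewrite big1 // => c ct; case: eqP => // xv; case: nex; exists c; rewrite ?xv.
have [v0] : exists v0, v0 \in [set v | [exists c in top k x0, x0 v == uL c]].
  by apply/card_gt0P; rewrite cleaves // muln_gt0.
rewrite inE => /exists_inP [c0 ct0 /eqP xv0].
apply: (@adversary_bound C _ T A (f_H H) compA _ _ (@star_graph n M) (@star_graph n M) R _ _ _ _ _ x0
   (upd x0 v0 (uF M))).
- move=> x y /RP [v [c [st ct xv ->]]]; apply/andP; split.
    exact: (stars_iso k0 hx0 st).
  by case/andP: (hy _ (stars_down k0 st xv ct)).
- move=> x e; apply: (@leq_mul_card_sub _ _ _ _ 1).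
  + by apply/subsetP => y; rewrite !inE => /andP[].
  + apply/card_le1_eqP => y y'; rewrite !inE.
    case/andP=> /RP [v [c [_ _ xv ->]]] /(diffx _ _ _ _ xv) d1.
    case/andP=> /RP [v' [c' [_ _ xv' ->]]] /(diffx _ _ _ _ xv') d2.
    (* One end of the edge is a centre in [x], so the leaf must be the other end. *)
    suff -> : v = v' by [].
    case/orP: d1 => /andP[/eqP e1 /eqP f1]; case/orP: d2 => /andP[/eqP e2 /eqP f2].
    * by rewrite -e1.
    * by move: xv; rewrite -e1 f2.
    * by move: xv; rewrite -e1 f2.
    * by rewrite -e1.
  case/set0Pn => y; rewrite !inE => /andP[/RP [_ [_ [st _ _ _]]] _]; rewrite muln1 -(cleaves x st).
  rewrite -(@card_in_imset _ _ (fun v => upd x v (uF M))); last first.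
    move=> v v' /[!inE] /exists_inP [c _ /eqP xv] _ /ffunP/(_ v); rewrite !ffunE eqxx.
    by case: eqP => // _; rewrite xv.
  apply: subset_leq_card; apply/subsetP => y' /imsetP [v /[!inE] /exists_inP [c ct /eqP xv] ->].
  exact: RI ct xv.
- move=> y e; apply: (@leq_mul_card_sub _ _ _ _ 1).
  + by apply/subsetP => x; rewrite !inE => /andP[].
  + apply/card_le1_eqP => x x'; rewrite !inE.
    case/andP=> /RP [v [c [_ _ xv yE]]] d1 /andP[/RP [v' [c' [_ _ xv' yE']]] d2].
    have yv : y v = uF M by rewrite yE ffunE eqxx.
    have yv' : y v' = uF M by rewrite yE' ffunE eqxx.
    have xE : x = upd y v (uL c) by rewrite yE -xv upd_upd.
    have xE' : x' = upd y v' (uL c') by rewrite yE' -xv' upd_upd.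
    rewrite xE in d1; rewrite xE' in d2; rewrite xE xE'.
    have {}d1 := star_differ yv d1; have {}d2 := star_differ yv' d2.
    (* The end that is free in [y] gives the vertex, and the label of the other end gives the
       star. *)
    case/orP: d1 => /andP[/eqP e1 /eqP f1]; case/orP: d2 => /andP[/eqP e2 /eqP f2].
    * by move: f2; rewrite f1 -e1 -e2 => -[->].
    * by move: yv; rewrite -e1 f2.
    * by move: yv; rewrite -e1 f2.
    * by move: f2; rewrite f1 -e1 -e2 => -[->].
  case/set0Pn => x; rewrite !inE => /andP[/RP [v [c [st ct xv yE]]] _]; rewrite muln1.
  have sty : stars t k m j y by rewrite yE; apply: stars_down ct.
  have [_ tj ta d1 _] := starsP k0 sty.
  have /andP[_ Fy] := hy _ sty.
  apply: (@leq_trans #|setX (active M m :\: top k y) [set v | y v == uF M]|).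
    by rewrite cardsX cardsD (setIidPr ta) tj leq_mul2l; apply/orP; right.
  rewrite -(@card_in_imset _ _ (fun cv => upd y cv.2 (uL cv.1))); last first.
    move=> [c1 v1] [c2 v2] /setXP[_ h1] _ /ffunP/(_ v1) /=.
    by rewrite inE in h1; rewrite !ffunE eqxx; case: eqP => [-> [->]|_] //; rewrite (eqP h1).
  apply: subset_leq_card; apply/subsetP => x' /imsetP [[c1 v1] /setXP[ca] /[!inE] /eqP yv1 ->] /=.
  have /setDP[c1a c1t] := ca.
  have := RI _ v1 c1 (stars_up k0 sty yv1 ca).
  rewrite -[X in upd (upd _ _ _) _ X]yv1 upd_upd; apply.
    rewrite inE; have := cnt_upd y v1 (uL c1) (uL c1).
    by rewrite yv1 eqxx addn0 addn1 d1 // => ->.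
  by rewrite ffunE eqxx.
exact: RI ct0 xv0.
Qed.
End StarBound.

Lemma card_active M m : m <= M -> #|active M m| = m.
Proof.
have winj mM : injective (@widen_ord m M mM) by move=> a b /(congr1 val) /= /val_inj.
move=> mM; rewrite -[RHS]card_ord -(card_imset _ (winj mM)).
apply: eq_card => c; rewrite inE; apply/idP/imsetP => [cm|[c' _ ->]] //=.
by exists (Ordinal cm) => //; apply: val_inj.
Qed.

Lemma sum_active M m k : m <= M -> \sum_(c < M) (if c < m then k else 0) = m * k.
Proof.
move=> mM; rewrite -big_mkcond /= sum_nat_const -[in RHS](card_active mM).
by congr (_ * _); apply: eq_card => c; rewrite !inE.
Qed.

Lemma stars_exist n M t k m : 0 < k -> m <= M -> t + M + m * k <= n ->
  exists l : {ffun 'I_n -> label M}, stars t k m m l.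
Proof.
move=> k0 mM hn.
pose kappa (a : label M) := match a with
  | inl b => if b then t else n - (t + M + m * k)
  | inr (inl _) => 1
  | inr (inr c) => if c < m then k else 0 end.
have [|l hl] := @exists_fibers n _ kappa.
  rewrite sum_label /= sum_active // sum1_card card_ord; lia.
have lL c : cnt l (uL c) = if c < m then k else 0 by rewrite /cnt hl.
exists l; apply/and3P; split.
- by apply/andP; split; [|apply/forallP => c]; rewrite /cnt hl.
- by apply/forallP => c; rewrite inE lL; case: (c < m); rewrite /= eqxx.
rewrite -[X in _ == X](card_active mM); apply/eqP/eq_card => c; rewrite !inE lL.
by case: ifP; rewrite ?eqxx // => _; rewrite eq_sym; apply/negbTE; rewrite -lt0n.
Qed.

(** The product [(j + 1) * (m - j)] is least at the ends of its range, where it is [m]; rounding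
    down to [m >= 1] at most halves [N / (4 k)], so [k * m >= N / 8]; and at least [N / 2] remains
    after two subtractions of at most [N / 4]. *)
Lemma star_product_bound N k m j : 0 < k -> 0 < m -> m = N %/ (4 * k) -> j < m ->
  N ^ 2 <= 16 * (j.+1 * k * ((m - j) * (N - N %/ 4 - m * k))).
Proof.
move=> k0 m0 mE jm.
have h1 : m <= j.+1 * (m - j) by nia.
have h2 : N <= 8 * (k * m).
  have : N < m.+1 * (4 * k) by rewrite mE; apply: ltn_ceil; lia.
  by nia.
have h3 : N <= 2 * (N - N %/ 4 - m * k).
  have := leq_trunc_div N 4; have := leq_trunc_div N (4 * k).
  by rewrite -mE; set q := N %/ 4; nia.
set F := N - _ - _ in h3 *.
have -> : j.+1 * k * ((m - j) * F) = k * (j.+1 * (m - j)) * F by ring.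
apply: (@leq_trans ((8 * (k * m)) * (2 * F))).
  by rewrite expnS expn1; apply: leq_mul.
have -> : 8 * (k * m) * (2 * F) = 16 * (k * m * F) by ring.
by rewrite leq_mul2l /= leq_mul2r leq_mul2l h1 !orbT.
Qed.

(** * The least star size and the least level that contain [H] *)

Section Sparse.
Variables (n : nat) (H : graph n) (J : {set 'I_n}).
Hypothesis indepJ : independent H J.
Hypothesis cardJ : #|J| = alpha H.

Lemma stars_free M t k m j (y : {ffun 'I_n -> label M}) : 0 < k -> m <= M ->
  stars t k m j y -> n - t - M - m * k <= cnt y (uF M).
Proof.
move=> k0 mM /(starsP k0) [/andP[/eqP yS /forallP yC] _ ta d1 d0].
have := sum_cnt y; rewrite sum_label yS.
rewrite (eq_bigr (fun=> 1)); last by move=> c _; apply/eqP.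
rewrite sum1_card card_ord.
have : \sum_c cnt y (uL c) <= m * k.
  rewrite -(sum_active k mM); apply: leq_sum => c _.
  have [ca|ca] := boolP (c \in active M m); last by rewrite d0.
  move: (ca); rewrite inE => ->.
  have [|/d1 <- //] := boolP (c \in top k y); by rewrite inE => /eqP ->.
by set X := (\sum_c _); lia.
Qed.

Lemma stars1_not_f_H M t m (y : {ffun 'I_n -> label M}) :
  t < #|~: J| -> stars t 1 m 0 y -> ~~ f_H H (star_graph y).
Proof.
move=> tJ /(starsP (ltn0Sn 0)) [/andP[/eqP yS _] t0 _ d1 d0].
apply: (@not_f_H_cover _ _ _ indepJ cardJ _ [set v | y v == uS M]); first by rewrite -/(cnt y (uS M)) yS.
have noleaf v c : y v != uL c.
  apply/negP => yv; have : 0 < cnt y (uL c) by apply/card_gt0P; exists v; rewrite inE.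
  have [ca|ca] := boolP (c \in active M m); last by rewrite d0.
  by rewrite lt0n -eqSS d1 // (cards0_eq t0) inE.
move=> u v; rewrite adj_mkgraph !inE => /andP[_].
have := noleaf u; have := noleaf v.
by case: (y u) => [[]|[c|c]]; case: (y v) => [[]|[c'|c']] //= h1 h2;
   rewrite ?orbF; try (by have := h1 c'; rewrite eqxx); have := h2 c; rewrite eqxx.
Qed.

Definition prune M m (l : {ffun 'I_n -> label M}) : {ffun 'I_n -> label M} :=
  [ffun v => if l v is inr (inr c) then if c < m then uL c else uF M else l v].

(** Links consecutive star sizes: full stars with [k] leaves, cut down to the first [m] stars, form
    level 0 for size [k + 1]. *)
Lemma prune_stars M t k m m' (l : {ffun 'I_n -> label M}) : 0 < k -> m <= m' ->
  stars t k m' m' l -> m' <= M -> stars t k.+1 m 0 (prune m l).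
Proof.
move=> k0 mm' /(starsP k0) [st tj ta _ d0] m'M.
have topE : top k l = active M m'.
  by apply/eqP; rewrite eqEcard ta tj card_active // leqnn.
have pE a : (if a is inr (inr c) then c < m else a != uF M) -> cnt (prune m l) a = cnt l a.
  move=> ha; apply: eq_card => v; rewrite !inE ffunE.
  case E: (l v) => [b|[c|c]] //; case: ifP => // cm; case: a ha => [b|[c'|c']] //=.
    by case: b.
  by move=> cm'; apply/esym/negbTE/eqP => -[cc]; rewrite cc cm' in cm.
have pL c : cnt (prune m l) (uL c) = if c < m then k else 0.
  case: ifP => cm.
    rewrite pE //; have : c \in top k l by rewrite topE inE (leq_trans cm).
    by rewrite inE => /eqP.
  apply: eq_card0 => v; rewrite !inE ffunE.
  case: (l v) => [b|[c'|c']] //; case: ifP => // cm'; apply/negbTE/eqP => -[cc].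
  by rewrite -cc cm' in cm.
apply/and3P; split.
- case/andP: st => lS /forallP lC; apply/andP; split; first by rewrite pE.
  by apply/forallP => c; rewrite pE.
- by apply/forallP => c; rewrite inE pL; case: (c < m); rewrite ?eqxx ?orbT.
by apply/eqP/eq_card0 => c; rewrite inE pL; case: (c < m); apply/negbTE; lia.
Qed.

Lemma prune_mono M m (l : {ffun 'I_n -> label M}) :
  f_H H (star_graph (prune m l)) -> f_H H (star_graph l).
Proof.
apply: f_H_mono => u v; rewrite !adj_mkgraph !ffunE => /andP[->] /=.
case: (l u) => [[]|[c|c]]; case: (l v) => [[]|[c'|c']] //=; do ?case: ifP => //=.
Qed.

Lemma stars_full_f_H M t k m (l : {ffun 'I_n -> label M}) v0 :
  0 < m <= M -> t.+1 = #|~: J| -> v0 \notin J -> k = #|[set u in J | adj H v0 u]| -> 0 < k ->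
  stars t k m m l -> f_H H (star_graph l).
Proof.
case/andP=> m0 mM tJ v0J kE k0 /(starsP k0) [/andP[/eqP lS /forallP lC] tj ta _ _].
have topE : top k l = active M m by apply/eqP; rewrite eqEcard ta tj card_active // leqnn.
pose c0 : 'I_M := Ordinal (leq_trans m0 mM).
have [w] : exists w, w \in [set v | l v == uC c0].
  by apply/card_gt0P; rewrite -/(cnt l (uC c0)) (eqP (lC c0)).
rewrite inE => /eqP lw.
apply: (@f_H_star _ _ _ indepJ _ [set v | l v == uS M] [set v | l v == uL c0] w v0) => //.
- by rewrite -/(cnt l (uS M)) lS.
- have : c0 \in top k l by rewrite topE inE.
  by rewrite inE => /eqP ck; rewrite -kE -ck.
- by rewrite inE lw.
- by rewrite inE lw.
- rewrite -setI_eq0; apply/eqP/setP => x; rewrite !inE.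
  by case: eqP => // ->.
- by move=> a b; rewrite inE adj_mkgraph => /eqP -> ->.
move=> u; rewrite inE adj_mkgraph => /eqP lu; rewrite lw lu /= ?eqxx ?andbT.
by apply: contra_eq_neq lw => ->; rewrite lu.
Qed.

Variables (C : numClosedFieldType) (T : nat) (A : qalg C (edge n) T).
Hypothesis compA : computes A (f_H H).

Lemma bound_sparse v0 : v0 \notin J ->
  let d := #|[set u in J | adj H v0 u]| in
  0 < d -> 4 * d <= (alpha H).+1 ->
  exists2 p, (alpha H).+1 ^ 2 <= 16 * p & (sqrtC p%:R / 72%:R <= T%:R :> C)%R.
Proof.
move=> v0J d d0 dN; set N := (alpha H).+1.
have tJ : #|~: J|.-1.+1 = #|~: J| by rewrite (cardsD1 v0 (~: J)) inE v0J.
set t := #|~: J|.-1 in tJ.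
have ntN : n = t + N.
  by have := cardsC J; rewrite card_ord cardJ -tJ /N; lia.
pose M := N %/ 4; pose mk k := N %/ (4 * k).
have mkM k : 0 < k -> mk k <= M by move=> k0; rewrite /mk /M; apply: leq_div2l; lia.
have mkk k : mk k * k <= M.
  rewrite /mk /M leq_divRL //; have := leq_trunc_div N (4 * k).
  by set q := N %/ _; nia.
have M4 : M * 4 <= N by apply: leq_trunc_div.
pose full k := (0 < k) && [exists l : {ffun 'I_n -> label M},
   stars t k (mk k) (mk k) l && f_H H (star_graph l)].
have exl k : 0 < k -> exists l : {ffun 'I_n -> label M}, stars t k (mk k) (mk k) l.
  by move=> k0; apply: stars_exist; rewrite ?mkM // ntN; have := mkk k; lia.
have mk0 k : 0 < k -> 4 * k <= N -> 0 < mk k.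
  by move=> k0 kN; rewrite /mk divn_gt0 //; lia.
have fd : full d.
  rewrite /full d0; have [l hl] := exl d d0; apply/existsP; exists l; rewrite hl /=.
  by apply: (stars_full_f_H _ tJ v0J _ d0 hl); rewrite ?mkM ?mk0.
case: (ex_minnP (ex_intro _ d fd)) => k /andP[k0 /existsP [l1 /andP[st1 fl1]]] kmin.
have kd : k <= d by apply: kmin.
have kN : 4 * k <= N by rewrite /N; lia.
pose m := mk k.
have mM : m <= M by apply: mkM.
have m0 : 0 < m by apply: mk0.
(* Level 0 has [m] stars with [k - 1] leaves, which embed in the full forest of size [k - 1] because
   that has at least [m] stars; minimality of [k] excludes [H] there. For [k = 1] there are no
   leaves at all. *)
have st0 y : stars t k m 0 y -> ~~ f_H H (@star_graph n M y).
  move=> sy; case: k k0 kmin {kd kN} @m mM m0 sy {st1 l1 fl1} => // k _ kmin m mM m0 sy.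
  have [k1|k1] := posnP k.
    by rewrite k1 in sy; apply: stars1_not_f_H sy; rewrite -tJ.
  have [l' sl'] := exl k k1.
  have mm' : m <= mk k by rewrite /m /mk; apply: leq_div2l; lia.
  have sp := prune_stars k1 mm' sl' (mkM _ k1).
  apply/negP => fy; have fp := stars_iso (ltn0Sn k) sy sp fy.
  have fk : full k.
    by rewrite /full k1; apply/existsP; exists l'; rewrite sl' (prune_mono fp).
  by have := kmin _ fk; rewrite ltnn.
(* The least level containing [H] is positive by [st0], so it has a predecessor without [H]. *)
pose val j := [exists l : {ffun 'I_n -> label M}, stars t k m j l && f_H H (star_graph l)].
have vm : val m by apply/existsP; exists l1; rewrite st1.
case: (ex_minnP (ex_intro _ m vm)) => j0 /existsP [x0 /andP[sx0 fx0]] jmin.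
have j0m : j0 <= m by apply: jmin.
case: j0 jmin sx0 j0m => [|j] jmin sx0 jm; first by case/negP: (st0 _ sx0).
exists (j.+1 * k * ((m - j) * (N - M - m * k))); first exact: star_product_bound.
rewrite -{1}(card_active mM).
apply: (bound_stars compA k0 sx0 fx0) => y sy; apply/andP; split.
  apply/negP => fy; have vj : val j by apply/existsP; exists y; rewrite sy.
  by have := jmin _ vj; rewrite ltnn.
by have := stars_free k0 mM sy; rewrite {1}ntN addKn.
Qed.
End Sparse.

(** * The bound *)

Lemma query_bound (C : numClosedFieldType) n (H : graph n) T (A : qalg C (edge n) T) :
  (exists e : edge n, H e) -> computes A (f_H H) ->
  exists2 p, alpha H * n <= 64 * p & (sqrtC p%:R / 72%:R <= T%:R :> C)%R.
Proof.
move=> [e He] compA.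
have [J indepJ cardJ] := alpha_witness H.
have cc : #|~: J| + alpha H = n by rewrite addnC -cardJ cardsC card_ord.
have [v1 v1J] : exists v, v \notin J.
  have aH : adj H (val e).1 (val e).2.
    rewrite /adj; case: e He => -[a b] /= ab He.
    destruct (@idP (a < b)) as [h|h] => //.
    by rewrite (bool_irrelevance h ab).
  have [h1|] := boolP ((val e).1 \in J); last by exists (val e).1.
  have [h2|] := boolP ((val e).2 \in J); last by exists (val e).2.
  by move/independentP: indepJ => /(_ _ _ h1 h2); rewrite aH.
have tau_gt0 : 0 < #|~: J| by apply/card_gt0P; exists v1; rewrite inE.
pose deg v := #|[set u in J | adj H v u]|.
have [v0 v0J dmin] : exists2 v0, v0 \notin J & forall v, v \notin J -> deg v0 <= deg v.
  by case: (arg_minnP deg (v1J : [pred v | v \notin J] v1)) => v0 h h'; exists v0.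
(* Below the threshold, [alpha H <= 2 * uphalf (alpha H)] yields the factor [64 = 2 * 32]; above it,
   [31 * #|~: J| < alpha H], so [n] is close to [alpha H]. *)
have [small|big] := leqP n (32 * #|~: J|).
  exists (#|~: J| * uphalf (alpha H)); last exact: bound_cover compA _.
  have : alpha H <= 2 * uphalf (alpha H) by rewrite uphalf_half; lia.
  by move: small; set a := #|_|; set u := uphalf _; nia.
(* Otherwise [v0] could be added to the maximum independent set [J]. *)
have d_gt0 : 0 < deg v0.
  rewrite lt0n; apply/negP => /eqP /cards0_eq d0.
  suff : independent H (v0 |: J) by move/leq_alpha; rewrite cardsU1 v0J cardJ add1n ltnn.
  have nv0 u : u \in J -> ~~ adj H v0 u.
    by move=> uJ; move/setP/(_ u): d0; rewrite !inE uJ => /negbT.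
  apply/independentP => a b; rewrite !inE => /orP[/eqP ->|aJ] /orP[/eqP ->|bJ].
  - by rewrite adj_irr.
  - exact: nv0.
  - by rewrite adjC nv0.
  - by move/independentP: indepJ; apply.
have d_le : deg v0 <= alpha H.
  by rewrite -cardJ; apply: subset_leq_card; apply/subsetP => x; rewrite inE => /andP[].
have [sp|de] := leqP (4 * deg v0) (alpha H).+1.
  have [p hp bp] := bound_sparse indepJ cardJ compA v0J d_gt0 sp.
  exists p => //; move: hp; rewrite expnS expn1; nia.
(* Here [M > 0] since [N > 32], and [#|~: J| + M <= deg v0] since [#|~: J| < N / 31] and
   [deg v0 > N / 4]. *)
pose N := (alpha H).+1; pose M := N %/ 8.
have M8 : M * 8 <= N by apply: leq_trunc_div.
have M8' : N < M.+1 * 8 by apply: ltn_ceil.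
exists ((deg v0 - M).+1 * (M * (N - deg v0))); last first.
  by apply: (bound_dense indepJ cardJ compA v0J dmin); rewrite -/(deg v0) /N in M8 M8' *; lia.
(* Two positive integers have product at least their sum minus one, here [N - M]. *)
have h1 : 7 * N <= 8 * ((deg v0 - M).+1 * (N - deg v0)).
  have : N - M <= (deg v0 - M).+1 * (N - deg v0) by rewrite /N in M8 M8' *; nia.
  by lia.
have h2 : N <= 16 * M by rewrite /N in M8 M8' *; lia.
have -> : 64 * ((deg v0 - M).+1 * (M * (N - deg v0))) =
   4 * (16 * M * ((deg v0 - M).+1 * (N - deg v0))) by ring.
set X := _ * (N - _) in h1 *.
have : N * (7 * N) <= 16 * M * (8 * X) by apply: leq_mul.
have : 31 * n <= 32 * N by rewrite /N; lia.
have : alpha H <= N by [].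
set a := alpha H; nia.
Qed.

Local Open Scope ring_scope.

Theorem theorem1 :
  exists c : rat, 0 < c /\
    forall (C : numClosedFieldType) (n : nat) (H : graph n),
      (2 <= n)%N -> (exists e : edge n, H e) ->
      Q_ge (f_H H) (ratr c * sqrtC ((alpha H * n)%:R : C)).
Proof.
(* [576 = 72 * 8], with 72 from the adversary bound and 8 the square root of the factor 64 in
   [query_bound]. *)
pose c : nat := 576; exists c%:R^-1; split; first by rewrite invr_gt0 ltr0n.
move=> C n H _ He T A compA; have [p hp bp] := query_bound He compA.
have cE : c%:R = 72 * 8 :> C by rewrite -natrM.
apply: le_trans bp; rewrite fmorphV rmorph_nat.
have -> : sqrtC p%:R / 72 = c%:R^-1 * (8 * sqrtC p%:R) :> C by rewrite cE; field.
rewrite ler_pM2l ?invr_gt0 ?ltr0n //.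
have -> : 8 * sqrtC p%:R = sqrtC ((64 * p)%N%:R) :> C.
  rewrite natrM sqrtCM ?nnegrE ?ler0n //; congr (_ * _).
  by have -> : 64%:R = 8 ^+ 2 :> C; [rewrite -natrX|rewrite sqrCK].
by rewrite ler_sqrtC ?nnegrE ?ler0n // ler_nat.
Qed.
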